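(* $\langle\forall\forall^\infty\forall\rangle\not\le_{\sf m}\langle\exists^\infty\forall\rangle$.
   Context: Quantifiers range over $\omega$. $\exists^\infty n\,\varphi(n)$ means $\forall m\exists n\ge m\,\varphi(n)$ and $\forall^\infty n\,\varphi(n)$ means $\exists m\forall n\ge m\,\varphi(n)$. A quantifier-pattern is a finite string $\bar{\mathsf Q}=\mathsf Q_0\dots\mathsf Q_\ell$ over $\{\exists,\forall,\exists^\infty,\forall^\infty\}$. A $\bar{\mathsf Q}$-formula is $\varphi(\bar x)\equiv\mathsf Q_0n_0\dots\mathsf Q_\ell n_\ell\,\theta(n_0,\dots,n_\ell,\bar x)$ with $\theta$ bounded. The instance $\bar x$ is a tuple of natural numbers and/or total computable functions (computable elements of $\omega^\omega$). Spaces such as $\omega\times\omega^\omega$, $(\omega^\omega)^\omega$, $\omega^{\omega\times\omega}$ are identified with $\omega^\omega$ by computable pairing. Witnesses: for $\alpha\in\omega^\omega$, $\alpha\Vdash\varphi(\bar x)$ (''$\alpha$ is a witness for $\varphi(\bar x)$'') is defined by: $\alpha\Vdash\theta(\bar x)$ iff $\alpha=\bar x$ and $\theta(\bar x)$, for bounded $\theta$; $\langle t,\alpha\rangle\Vdash\exists n\varphi(n,\bar x)$ iff $\alpha\Vdash\varphi(t,\bar x)$; $\alpha\Vdash\forall n\varphi(n,\bar x)$ iff $\alpha(n)\Vdash\varphi(n,\bar x)$ for all $n$; $\langle t,\alpha\rangle\Vdash\forall^\infty n\varphi(n,\bar x)$ iff $\alpha(n)\Vdash\varphi(n,\bar x)$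 for all $n\ge t$; $\alpha\Vdash\exists^\infty n\varphi(n,\bar x)$ iff for all $n$, writing $\alpha(n)=\langle k,\beta\rangle$, $k\ge n$ and $\beta\Vdash\varphi(k,\bar x)$. $\varphi\le_{\sf m}\psi$ if there are computable functions $\eta,r_-,r_+$ (type-two computable functionals, possibly partial but defined wherever required) such that for every instance $\bar x$: $\varphi(\bar x)$ is true iff $\psi(\eta(\bar x))$ is true; $\alpha\Vdash\varphi(\bar x)$ implies $r_-(\alpha,\bar x)\Vdash\psi(\eta(\bar x))$; $\alpha\Vdash\psi(\eta(\bar x))$ implies $r_+(\alpha,\bar x)\Vdash\varphi(\bar x)$ ($\alpha\in\omega^\omega$ arbitrary). $\langle\bar{\mathsf Q}\rangle$ denotes a fixed $\bar{\mathsf Q}$-formula to which every $\bar{\mathsf Q}$-formula is $\le_{\sf m}$-reducible; concretely $\langle\bar{\mathsf Q}\rangle(x)\equiv\mathsf Q_0n_0\dots\mathsf Q_\ell n_\ell.\ x(n_0,\dots,n_\ell)=0$ (the choice does not matter up to $\equiv_{\sf m}$). *)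

(* Defs.v *)
From Stdlib Require Import Arith List Cantor.
Import ListNotations.

Definition baire := nat -> nat.

Definition npair (a b : nat) : nat := Cantor.to_nat (a, b).
Definition nfst (n : nat) : nat := fst (Cantor.of_nat n).
Definition nsnd (n : nat) : nat := snd (Cantor.of_nat n).

(** Identifications of product spaces with Baire space.  With
    [bcons t a = <t, a>], every [c : baire] is [<c 0, btail c>]; and every
    [a : baire], read in [(omega^omega)^omega], has [n]-th entry [brow a n]. *)
Definition bcons (t : nat) (a : baire) : baire :=
  fun n => match n with 0 => t | S m => a m end.
Definition btail (a : baire) : baire := fun n => a (S n).
Definition brow (a : baire) (n : nat) : baire := fun m => a (npair n m).
Definition bjoin (a b : baire) : baire :=
  fun n => if Nat.even n then a (Nat.div2 n) else b (Nat.div2 n).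

(** Partial recursive functions relative to an oracle in Baire space.
    All functions are unary, several arguments being passed through [npair]. *)
Inductive code : Type :=
| cZero | cSucc | cFst | cSnd | cOracle
| cPair (f g : code)
| cComp (f g : code)
| cRec (f g : code)
| cMu (f : code).

(** [eval o c n v]: with oracle [o], program [c] halts on input [n] with
    value [v].  [cRec f g] is primitive recursion on the second argument with
    the first one as a parameter; [cMu f] on input [n] searches for the least
    [v] with [f (n, v) = 0], and requires [f] to halt at all smaller values. *)
Fixpoint eval (o : baire) (c : code) (n v : nat) {struct c} : Prop :=
  match c with
  | cZero => v = 0
  | cSucc => v = S n
  | cFst => v = nfst n
  | cSnd => v = nsnd n
  | cOracle => v = o n
  | cPair f g => exists a b, eval o f n a /\ eval o g n b /\ v = npair a b
  | cComp f g => exists a, eval o g n a /\ eval o f a v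
  | cRec f g =>
      nat_rect (fun _ => nat -> Prop)
        (eval o f (nfst n))
        (fun i R w => exists u,
             R u /\ eval o g (npair (nfst n) (npair i u)) w)
        (nsnd n) v
  | cMu f =>
      eval o f (npair n v) 0 /\
      forall i, i < v -> exists u, eval o f (npair n i) (S u)
  end.

(** The partial type-two functional computed by [c] is defined at [a] with
    value [b]. *)
Definition maps_to (c : code) (a b : baire) : Prop :=
  forall n, eval a c n (b n).

(** The constant zero oracle is computable, so it adds no power. *)
Definition computable (x : baire) : Prop :=
  exists c, maps_to c (fun _ => 0) x.

Inductive quant : Type := qEx | qAll | qInf | qAlm.

(** A prenex formula over an instance in Baire space; [matrix ns x] receives
    the values [ns = [n_0; ...; n_l]] of the quantified variables. *)
Record formula : Type := Formula {
  prefix : list quant;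
  matrix : list nat -> baire -> Prop
}.

Fixpoint holds_from (Q : list quant) (theta : list nat -> baire -> Prop)
    (ns : list nat) (x : baire) : Prop :=
  match Q with
  | [] => theta ns x
  | qEx :: Q' => exists n, holds_from Q' theta (ns ++ [n]) x
  | qAll :: Q' => forall n, holds_from Q' theta (ns ++ [n]) x
  | qInf :: Q' =>
      forall m, exists n, m <= n /\ holds_from Q' theta (ns ++ [n]) x
  | qAlm :: Q' =>
      exists m, forall n, m <= n -> holds_from Q' theta (ns ++ [n]) x
  end.

(** For a bounded formula the only possible witness is its full tuple of
    arguments, here [<n_0, <n_1, ... <n_l, x>>>]. *)
Fixpoint witness_from (Q : list quant) (theta : list nat -> baire -> Prop)
    (ns : list nat) (x : baire) (a : baire) : Prop :=
  match Q with
  | [] => (forall i, a i = fold_right bcons x ns i) /\ theta ns x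
  | qEx :: Q' => witness_from Q' theta (ns ++ [a 0]) x (btail a)
  | qAll :: Q' =>
      forall n, witness_from Q' theta (ns ++ [n]) x (brow a n)
  | qInf :: Q' =>
      forall n, let k := brow a n 0 in
        n <= k /\ witness_from Q' theta (ns ++ [k]) x (btail (brow a n))
  | qAlm :: Q' =>
      forall n, a 0 <= n ->
        witness_from Q' theta (ns ++ [n]) x (brow (btail a) n)
  end.

Definition holds (phi : formula) (x : baire) : Prop :=
  holds_from (prefix phi) (matrix phi) [] x.

Definition witness (phi : formula) (x a : baire) : Prop :=
  witness_from (prefix phi) (matrix phi) [] x a.

(** Instances are computable, whereas witnesses are arbitrary.  As [eval] is
    single-valued, [y] below is the value of [eta] at [x], and it is again
    computable. *)
Definition m_reducible (phi psi : formula) : Prop :=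
  exists eta r_minus r_plus : code,
    forall x : baire, computable x ->
      exists y : baire,
        maps_to eta x y /\
        (holds phi x <-> holds psi y) /\
        (forall a, witness phi x a ->
           exists b, maps_to r_minus (bjoin a x) b /\ witness psi y b) /\
        (forall a, witness psi y a ->
           exists b, maps_to r_plus (bjoin a x) b /\ witness phi x b).

(** [x(n_0, ..., n_l)] is [x] at the code [(n_0, (n_1, (..., n_l)))]; the
    value at the empty list is immaterial. *)
Fixpoint tuple_code (ns : list nat) : nat :=
  match ns with
  | [] => 0
  | [n] => n
  | n :: ns' => npair n (tuple_code ns')
  end.

Definition canonical (Q : list quant) : formula :=
  Formula Q (fun ns x => x (tuple_code ns) = 0).

(* Main.v *)
Require Import Defs.
From Stdlib Require Import List.
Import ListNotations.
From Stdlib Require Import Arith Lia Cantor Classical ClassicalEpsilon.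

(** Suppose there were a reduction.  Everything takes place near the zero
    instance.  For bounds [t] on the first [j] rows, say that [k] is forced if
    [forall m, y(k,m) = 0] holds for the image [y] of every true instance that
    is close enough to zero and respects those [j] bounds, and that [k] is
    barred by [t|j] if every infinite extension of [t|j] has an initial segment
    forcing [k].

    Only boundedly many [k] are barred by [t|j]: otherwise feed an infinite
    sequence of them to [r_plus], which produces a bound [T] for row [j] after
    reading finitely many of them; a single error at column [T] of row [j], far
    out, keeps all of these valid, and so refutes [T].

    The sets barred by [t|j] extended by [N] decrease in [N] to the set barred by
    [t|j], so by boundedness they are equal to it for large [N].  This gives a
    [t] all of whose initial segments bar the same bounded set.  But by
    continuity everything [r_minus] outputs on [t] at the zero instance is
    forced by an initial segment of [t], and these outputs are unbounded. *)

(** * Finite agreement of sequences, pairing, uniform bounds and choice *)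

Definition agree (U : nat) (a b : baire) : Prop := forall i, i < U -> a i = b i.

Lemma agree_le (U V : nat) (a b : baire) : U <= V -> agree V a b -> agree U a b.
Proof. intros HUV H i Hi. apply H. lia. Qed.

Lemma agree_bcons (U t : nat) (a b : baire) :
  agree U a b -> agree U (bcons t a) (bcons t b).
Proof. intros H [|i] Hi; simpl; [reflexivity|]. apply H. lia. Qed.

Lemma agree_bjoin (U : nat) (a a' x x' : baire) :
  agree U a a' -> agree U x x' -> agree U (bjoin a x) (bjoin a' x').
Proof.
  intros Ha Hx i Hi. unfold bjoin.
  pose proof (Nat.div2_decr i i (Nat.le_succ_diag_r i)).
  destruct (Nat.even i); [apply Ha|apply Hx]; lia.
Qed.

Lemma nfst_npair (a b : nat) : nfst (npair a b) = a.
Proof. unfold nfst, npair. now rewrite Cantor.cancel_of_to. Qed.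

Lemma nsnd_npair (a b : nat) : nsnd (npair a b) = b.
Proof. unfold nsnd, npair. now rewrite Cantor.cancel_of_to. Qed.

Lemma npair_eta (n : nat) : npair (nfst n) (nsnd n) = n.
Proof.
  unfold nfst, nsnd, npair. rewrite <- surjective_pairing.
  apply Cantor.cancel_to_of.
Qed.

Lemma npair_ge (a b : nat) : a + b <= npair a b.
Proof. unfold npair. pose proof (Cantor.to_nat_non_decreasing a b). lia. Qed.

Lemma nfst_nsnd_le (n : nat) : nfst n + nsnd n <= n.
Proof. pose proof (npair_ge (nfst n) (nsnd n)). rewrite npair_eta in H. exact H. Qed.

Lemma bounded_max (P : nat -> nat -> Prop) (n : nat) :
  (forall i u v, u <= v -> P i u -> P i v) ->
  (forall i, i < n -> exists u, P i u) ->
  exists u, forall i, i < n -> P i u.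
Proof.
  intros Hmon. induction n as [|n IH]; intros H.
  - exists 0. lia.
  - destruct IH as [u Hu]; [intros i Hi; apply H; lia|].
    destruct (H n) as [v Hv]; [lia|].
    exists (max u v). intros i Hi.
    destruct (Nat.eq_dec i n) as [->|Hne].
    + apply Hmon with v; [lia|exact Hv].
    + apply Hmon with u; [lia|]. apply Hu. lia.
Qed.

Lemma choice_fun {A B : Type} (R : A -> B -> Prop) :
  (forall x, exists y, R x y) -> exists f, forall x, R x (f x).
Proof.
  intros H.
  exists (fun x => proj1_sig (constructive_indefinite_description _ (H x))).
  intros x. apply proj2_sig.
Qed.

(** * Determinism and continuity of oracle computations *)

Lemma eval_det (o : baire) (c : code) :
  forall n v w, eval o c n v -> eval o c n w -> v = w.
Proof.
  induction c as [| | | | |f IHf g IHg|f IHf g IHg|f IHf g IHg|f IHf];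
    intros n v w; simpl; try congruence.
  - intros (a & b & Ha & Hb & ->) (a' & b' & Ha' & Hb' & ->).
    now rewrite (IHf _ _ _ Ha Ha'), (IHg _ _ _ Hb Hb').
  - intros (a & Ha & Hv) (a' & Ha' & Hw).
    rewrite (IHg _ _ _ Ha Ha') in Hv. eapply IHf; eauto.
  - revert v w. induction (nsnd n) as [|i IHi]; simpl; intros v w.
    + apply IHf.
    + intros (u & Hu & Hv) (u' & Hu' & Hw).
      rewrite (IHi _ _ Hu Hu') in Hv. eapply IHg; eauto.
  - intros [Hv Hv'] [Hw Hw'].
    destruct (lt_eq_lt_dec v w) as [[H|H]|H]; [|exact H|].
    + destruct (Hw' v H) as [u Hu]. discriminate (IHf _ _ _ Hv Hu).
    + destruct (Hv' w H) as [u Hu]. discriminate (IHf _ _ _ Hw Hu).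
Qed.

(** A halting computation queries the oracle finitely often. For [cMu], the finitely many failed
    tests get a common use bound from [bounded_max]. *)
Lemma eval_use (o : baire) (c : code) :
  forall n v, eval o c n v ->
  exists U, forall o', agree U o o' -> eval o' c n v.
Proof.
  induction c as [| | | | |f IHf g IHg|f IHf g IHg|f IHf g IHg|f IHf];
    intros n v; simpl; try (intros H; exists 0; intros _ _; exact H).
  - intros ->. exists (S n). intros o' H. apply H. lia.
  - intros (a & b & Ha & Hb & ->).
    destruct (IHf _ _ Ha) as [U HU], (IHg _ _ Hb) as [V HV].
    exists (max U V). intros o' H. exists a, b. repeat split.
    + apply HU. apply agree_le with (max U V); [lia|exact H].
    + apply HV. apply agree_le with (max U V); [lia|exact H].
  - intros (a & Ha & Hv).
    destruct (IHg _ _ Ha) as [U HU], (IHf _ _ Hv) as [V HV].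
    exists (max U V). intros o' H. exists a. split.
    + apply HU. apply agree_le with (max U V); [lia|exact H].
    + apply HV. apply agree_le with (max U V); [lia|exact H].
  - revert v. induction (nsnd n) as [|i IHi]; simpl; intros v.
    + apply IHf.
    + intros (u & Hu & Hv).
      destruct (IHi _ Hu) as [U HU], (IHg _ _ Hv) as [V HV].
      exists (max U V). intros o' H. exists u. split.
      * apply HU. apply agree_le with (max U V); [lia|exact H].
      * apply HV. apply agree_le with (max U V); [lia|exact H].
  - intros [Hv Hlt]. destruct (IHf _ _ Hv) as [U HU].
    destruct (bounded_max
      (fun i W => forall o', agree W o o' ->
         exists u, eval o' f (npair n i) (S u)) v) as [W HW].
    + intros i W W' HWW H o' Ho. apply H. now apply agree_le with W'.
    + intros i Hi. destruct (Hlt i Hi) as [u Hu].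
      destruct (IHf _ _ Hu) as [W HW]. exists W.
      intros o' Ho. exists u. now apply HW.
    + exists (max U W). intros o' H. split.
      * apply HU. apply agree_le with (max U W); [lia|exact H].
      * intros i Hi. apply HW; [exact Hi|].
        apply agree_le with (max U W); [lia|exact H].
Qed.

Lemma maps_to_use (c : code) (o v : baire) (n : nat) :
  maps_to c o v -> exists U, forall o' v', agree U o o' -> maps_to c o' v' ->
    agree n v v'.
Proof.
  intros H.
  destruct (bounded_max (fun i U => forall o', agree U o o' -> eval o' c i (v i)) n)
    as [U HU].
  - intros i U V HUV Hi o' Ho. apply Hi. now apply agree_le with V.
  - intros i _. apply eval_use, H.
  - exists U. intros o' v' Ho Hv i Hi. apply (eval_det o' c i); auto.
Qed.

(** * Computability of constants and of instances with a single error *)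

Lemma computable_const (t : nat) : computable (fun _ => t).
Proof.
  induction t as [|t [c Hc]].
  - exists cZero. intros n. reflexivity.
  - exists (cComp cSucc c). intros n. exists t. split; [apply Hc|reflexivity].
Qed.

Lemma computable_bcons (t : nat) (x : baire) :
  computable x -> computable (bcons t x).
Proof.
  destruct (computable_const t) as [d Hd]. intros [c Hc].
  (* [cRec] acts as a case distinction: its step ignores the recursive value and runs [c] on the
     predecessor. The parameter 0 is a dummy. *)
  exists (cComp (cRec d (cComp c (cComp cFst cSnd)))
                (cPair cZero (cPair cFst cSnd))).
  intros n. exists (npair 0 n). split.
  - exists 0, n. repeat split.
    exists (nfst n), (nsnd n). repeat split. symmetry. apply npair_eta.
  - simpl. rewrite nfst_npair, nsnd_npair.
    induction n as [|n IH]; simpl.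
    + apply Hd.
    + exists (bcons t x n). split; [exact IH|].
      exists n. split; [|apply Hc].
      exists (npair n (bcons t x n)). now rewrite nsnd_npair, nfst_npair.
Qed.

(** Built from [bcons] so that computability follows by induction from [computable_bcons]. *)
Fixpoint spike (q : nat) : baire :=
  match q with
  | 0 => bcons 1 (fun _ => 0)
  | S q' => bcons 0 (spike q')
  end.

Lemma computable_spike (q : nat) : computable (spike q).
Proof.
  induction q as [|q IH]; apply computable_bcons; [apply computable_const|exact IH].
Qed.

Lemma spike_on (q : nat) : spike q q = 1.
Proof. now induction q. Qed.

Lemma spike_off (q i : nat) : i <> q -> spike q i = 0.
Proof.
  revert i. induction q as [|q IH]; intros [|i] H; simpl; try lia.
  apply IH. lia.
Qed.

(** * Explicit witnesses and their continuity *)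

Definition source : formula := canonical [qAll; qAlm; qAll].
Definition target : formula := canonical [qInf; qAll].

(** Apart from the bounds, a witness only repeats its arguments. Columns below the bound are filled
    in the same way, since nothing is required there. *)
Definition alm_witness (t : nat -> nat) (x : baire) : baire := fun p =>
  match nsnd p with
  | 0 => t (nfst p)
  | S r => fold_right bcons x [nfst p; nfst r; nfst (nsnd r)] (nsnd (nsnd r))
  end.

Definition inf_witness (s : nat -> nat) (y : baire) : baire := fun p =>
  match nsnd p with
  | 0 => s (nfst p)
  | S r => fold_right bcons y [s (nfst p); nfst r] (nsnd r)
  end.

Lemma alm_witness_correct (t : nat -> nat) (x : baire) :
  (forall a n m, t a <= n -> x (npair a (npair n m)) = 0) ->
  witness source x (alm_witness t x).
Proof.
  intros H a n Hn m. split.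
  - intros i. unfold brow, btail, alm_witness.
    now repeat rewrite ?nfst_npair, ?nsnd_npair.
  - apply H. revert Hn. unfold brow, alm_witness.
    now rewrite nsnd_npair, nfst_npair.
Qed.

Lemma inf_witness_correct (s : nat -> nat) (y : baire) :
  (forall n, n <= s n /\ forall m, y (npair (s n) m) = 0) ->
  witness target y (inf_witness s y).
Proof.
  intros H n.
  assert (Hk : brow (inf_witness s y) n 0 = s n)
    by (unfold brow, inf_witness; now rewrite nsnd_npair, nfst_npair).
  simpl. rewrite Hk. split; [apply H|].
  intros m. split; [|apply H].
  intros i. unfold brow, btail, inf_witness.
  now repeat rewrite ?nfst_npair, ?nsnd_npair.
Qed.

(** Unpairing does not increase numbers, so entry [p] reads [t] and [x] only at arguments at most
    [p]. *)
Lemma agree_alm_witness (U : nat) (t t' : nat -> nat) (x x' : baire) :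
  agree U t t' -> agree U x x' -> agree U (alm_witness t x) (alm_witness t' x').
Proof.
  intros Ht Hx p Hp. unfold alm_witness.
  pose proof (nfst_nsnd_le p). destruct (nsnd p) as [|r]; [apply Ht; lia|].
  pose proof (nfst_nsnd_le r). pose proof (nfst_nsnd_le (nsnd r)).
  cbn [fold_right]. apply (agree_bcons U); [|lia].
  now apply agree_bcons, agree_bcons.
Qed.

Lemma agree_inf_witness (U : nat) (s s' : nat -> nat) (y y' : baire) :
  agree U s s' -> agree U y y' -> agree U (inf_witness s y) (inf_witness s' y').
Proof.
  intros Hs Hy p Hp. unfold inf_witness.
  pose proof (nfst_nsnd_le p). destruct (nsnd p) as [|r]; [apply Hs; lia|].
  pose proof (nfst_nsnd_le r).
  rewrite (Hs (nfst p)) by lia.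
  cbn [fold_right]. apply (agree_bcons U); [|lia].
  now apply agree_bcons.
Qed.

(** * Forced and barred numbers *)

Definition reduction (eta r_minus r_plus : code) : Prop :=
  forall x : baire, computable x ->
    exists y : baire,
      maps_to eta x y /\
      (holds source x <-> holds target y) /\
      (forall a, witness source x a ->
         exists b, maps_to r_minus (bjoin a x) b /\ witness target y b) /\
      (forall a, witness target y a ->
         exists b, maps_to r_plus (bjoin a x) b /\ witness source x b).

Definition good (eta : code) (x : baire) (k : nat) : Prop :=
  forall m, eval x eta (npair k m) 0.

Lemma good_iff (eta : code) (x y : baire) (k : nat) :
  maps_to eta x y -> good eta x k <-> forall m, y (npair k m) = 0.
Proof.
  intros H. split; intros Hk m.
  - exact (eval_det _ _ _ _ _ (H _) (Hk m)).
  - rewrite <- (Hk m). apply H.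
Qed.

Definition respects (t : nat -> nat) (j : nat) (x : baire) : Prop :=
  forall a n m, a < j -> t a <= n -> x (npair a (npair n m)) = 0.

Definition forced (eta : code) (t : nat -> nat) (j k : nat) : Prop :=
  exists L, forall x, computable x -> holds source x ->
    agree L (fun _ => 0) x -> respects t j x -> good eta x k.

(** Unlike [forced], this holds at [t|j] as soon as it holds at all extensions of [t|j] by one
    value; [barred_extend] relies on that. *)
Definition barred (eta : code) (t : nat -> nat) (j k : nat) : Prop :=
  forall t', agree j t t' -> exists j', forced eta t' j' k.

Lemma zero_holds : holds source (fun _ => 0).
Proof. intros a. exists 0. intros n _ m. reflexivity. Qed.

Lemma forced_good_zero (eta : code) (t : nat -> nat) (j k : nat) :
  forced eta t j k -> good eta (fun _ => 0) k.
Proof.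
  intros [L H]. apply H.
  - apply computable_const.
  - apply zero_holds.
  - intros i _. reflexivity.
  - intros a n m _ _. reflexivity.
Qed.

(** More bounds, or smaller ones, are respected by fewer instances. *)
Lemma forced_weaken (eta : code) (t t' : nat -> nat) (j j' k : nat) :
  j <= j' -> (forall a, a < j -> t' a <= t a) ->
  forced eta t j k -> forced eta t' j' k.
Proof.
  intros Hj Ht [L H]. exists L. intros x Hc Hh Hx Hr. apply H; auto.
  intros a n m Ha Hn. apply Hr; [lia|]. specialize (Ht a Ha). lia.
Qed.

Lemma forced_barred (eta : code) (t : nat -> nat) (j k : nat) :
  forced eta t j k -> barred eta t j k.
Proof.
  intros H t' Ht. exists j. apply forced_weaken with t j; auto.
  intros a Ha. now rewrite (Ht a Ha).
Qed.

Lemma barred_agree (eta : code) (t t' : nat -> nat) (j k : nat) :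
  agree j t t' -> barred eta t j k -> barred eta t' j k.
Proof.
  intros Ht H u Hu. apply H. intros i Hi. rewrite (Ht i Hi). now apply Hu.
Qed.

Definition update (t : nat -> nat) (j N : nat) : nat -> nat :=
  fun i => if i =? j then N else t i.

Lemma update_eq (t : nat -> nat) (j N : nat) : update t j N j = N.
Proof. unfold update. now rewrite Nat.eqb_refl. Qed.

Lemma update_neq (t : nat -> nat) (j N i : nat) : i <> j -> update t j N i = t i.
Proof. intros H. unfold update. now apply Nat.eqb_neq in H as ->. Qed.

(** Raise entry [j] of the given extension to [N'], take a forcing initial segment, and lower the
    entry again by [forced_weaken]. *)
Lemma barred_update_anti (eta : code) (t : nat -> nat) (j N N' k : nat) :
  N <= N' -> barred eta (update t j N') (S j) k -> barred eta (update t j N) (S j) k.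
Proof.
  intros HN H t' Ht.
  destruct (H (update t' j N')) as [j' Hj'].
  - intros i Hi. destruct (Nat.eq_dec i j) as [->|Hne].
    + now rewrite !update_eq.
    + rewrite !update_neq by exact Hne. rewrite <- (Ht i Hi).
      now rewrite update_neq.
  - exists j'. apply forced_weaken with (update t' j N') j'; auto.
    intros a _. destruct (Nat.eq_dec a j) as [->|Hne].
    + rewrite update_eq, <- (Ht j) by lia. now rewrite update_eq.
    + now rewrite update_neq.
Qed.

(** * Boundedness of the barred sets *)

Lemma spike_holds (q : nat) : holds source (spike q).
Proof.
  intros a. exists (S q). intros n Hn m. simpl. apply spike_off.
  pose proof (npair_ge n m). pose proof (npair_ge a (npair n m)). lia.
Qed.

Lemma barred_bounded (eta r_minus r_plus : code) (t : nat -> nat) (j : nat) :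
  reduction eta r_minus r_plus -> exists B, forall k, barred eta t j k -> k < B.
Proof.
  intros Hred. apply NNPP. intros Hunb.
  assert (Hs : forall n, exists k, n <= k /\ barred eta t j k).
  { intros n. apply NNPP. intros Hn. apply Hunb. exists n. intros k Hk.
    destruct (le_lt_dec n k); [|assumption]. exfalso. eauto. }
  apply choice_fun in Hs as [s Hs].
  destruct (Hred _ (computable_const 0)) as (y & Hy & _ & _ & Hplus).
  destruct (Hplus (inf_witness s y)) as (c & Hc & _).
  { apply inf_witness_correct. intros n. split; [apply Hs|].
    apply (good_iff _ _ _ _ Hy).
    destruct (proj2 (Hs n) t) as [j' Hj']; [now intros i _|].
    exact (forced_good_zero _ _ _ _ Hj'). }
  (* The bound that [r_plus] claims for row [j] of the zero instance. *)
  set (T := c (npair j 0)).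
  destruct (maps_to_use _ _ _ (S (npair j 0)) Hc) as [U HU].
  (* The target witness also contains the image [y], so its part below [U] depends on the instance,
     here below [V]. *)
  destruct (maps_to_use _ _ _ U Hy) as [V HV].
  (* With bound [S T] on row [j], an error at column [T] is still allowed. *)
  set (t' := update t j (S T)).
  assert (Htt' : agree j t t').
  { intros i Hi. unfold t'. rewrite update_neq; [reflexivity|lia]. }
  destruct (bounded_max (fun n L => forall q, L <= q ->
      (exists m, q = npair j (npair T m)) -> good eta (spike q) (s n)) U)
    as [L HL].
  { intros n L L' HLL H q Hq. apply H. lia. }
  { intros n _. destruct (proj2 (Hs n) t' Htt') as (j' & L & HL).
    exists L. intros q Hq [m ->]. apply HL.
    - apply computable_spike.
    - apply spike_holds.
    - intros i Hi. rewrite spike_off; [reflexivity|lia].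
    - intros a p m' Ha Hp. apply spike_off. intros E.
      pose proof (f_equal nfst E) as E1. pose proof (f_equal nsnd E) as E2.
      rewrite !nfst_npair in E1. rewrite !nsnd_npair in E2.
      apply (f_equal nfst) in E2. rewrite !nfst_npair in E2. subst a p.
      unfold t' in Hp. rewrite update_eq in Hp. lia. }
  (* Row [j] and column [T] are fixed; the innermost coordinate [m] pushes the error beyond [U], [V]
     and [L]. *)
  set (m := U + V + L). set (q := npair j (npair T m)).
  assert (Hq : m <= q).
  { unfold q. pose proof (npair_ge T m). pose proof (npair_ge j (npair T m)). lia. }
  assert (Hzero : forall W, W <= m -> agree W (fun _ => 0) (spike q)).
  { intros W HW i Hi. rewrite spike_off; [reflexivity|lia]. }
  destruct (Hred _ (computable_spike q)) as (y' & Hy' & Hiff & _ & Hplus').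
  (* Below [U] the old outputs stay valid; from [U] on, use that the image of the true instance
     [spike q] is true. *)
  assert (Hinf : forall n, exists k,
      (n < U -> k = s n) /\ n <= k /\ forall i, y' (npair k i) = 0).
  { intros n. destruct (le_lt_dec U n) as [HUn|HUn].
    - destruct (proj1 Hiff (spike_holds q) n) as (k & Hnk & Hk).
      exists k. split; [lia|]. split; [exact Hnk|exact Hk].
    - exists (s n). split; [reflexivity|]. split; [apply Hs|].
      apply (good_iff _ _ _ _ Hy'). apply HL; [exact HUn|lia|now exists m]. }
  apply choice_fun in Hinf as [s' Hs'].
  destruct (Hplus' (inf_witness s' y')) as (c' & Hc' & Hw').
  { apply inf_witness_correct. intros n. apply Hs'. }
  assert (HT : T = c' (npair j 0)).
  { apply (HU (bjoin (inf_witness s' y') (spike q)) c'); [|exact Hc'|lia].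
    apply agree_bjoin; [|apply Hzero; lia].
    apply agree_inf_witness.
    - intros i Hi. symmetry. now apply Hs'.
    - apply (HV (spike q) y'); [apply Hzero; lia|exact Hy']. }
  (* By continuity [r_plus] claims the same [T] for the spike, although the error sits at column
     [T]. *)
  destruct (Hw' j T) with (n := m) as [_ Hbad].
  - unfold brow. lia.
  - change (spike q q = 0) in Hbad. rewrite spike_on in Hbad. discriminate.
Qed.

(** * Bounds along which the barred set is constant *)

Lemma barred_extend (eta r_minus r_plus : code) (t : nat -> nat) (j : nat) :
  reduction eta r_minus r_plus ->
  exists N, forall k, barred eta (update t j N) (S j) k -> barred eta t j k.
Proof.
  intros Hred.
  (* The sets decrease in [N], so the bound for [N = 0] serves all [N] and only finitely many [k]
     need treatment. *)
  destruct (barred_bounded _ _ _ (update t j 0) (S j) Hred) as [B HB].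
  destruct (bounded_max (fun k N =>
      barred eta (update t j N) (S j) k -> barred eta t j k) B) as [N HN].
  - intros k N N' HNN H Hk. apply H. now apply barred_update_anti with N'.
  - intros k _. destruct (classic (barred eta t j k)) as [Hk|Hk].
    + now exists 0.
    + apply not_all_ex_not in Hk as [t' Ht'].
      apply imply_to_and in Ht' as [Ht Hnot].
      (* [t'] is an extension of [t|j] with no initial segment forcing [k], so its own entry at [j]
         already prevents [k] from being barred. *)
      exists (t' j). intros Hb. exfalso. apply Hnot, Hb.
      intros i Hi. destruct (Nat.eq_dec i j) as [->|Hne].
      * apply update_eq.
      * rewrite update_neq by exact Hne. apply Ht. lia.
  - exists N. intros k Hk. apply HN; [|exact Hk].
    apply HB, barred_update_anti with N; [lia|exact Hk].
Qed.

Lemma stable_bounds (eta r_minus r_plus : code) :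
  reduction eta r_minus r_plus ->
  exists t, forall j k, barred eta t j k -> barred eta (fun _ => 0) 0 k.
Proof.
  intros Hred.
  destruct (choice_fun (fun (p : (nat -> nat) * nat) N => forall k,
    barred eta (update (fst p) (snd p) N) (S (snd p)) k ->
    barred eta (fst p) (snd p) k)) as [F HF].
  { intros [t j]. exact (barred_extend _ _ _ t j Hred). }
  (* Stage [j] has fixed the entries below [j]; the required sequence is the diagonal limit of the
     stages. *)
  set (f := nat_rect (fun _ => nat -> nat) (fun _ => 0)
              (fun j t => update t j (F (t, j)))).
  assert (Hf : forall j i, i < j -> f j i = f (S i) i).
  { intros j i Hi. induction Hi as [|j Hi IH]; [reflexivity|].
    rewrite <- IH. apply update_neq. lia. }
  exists (fun i => f (S i) i). intros j k Hk.
  apply barred_agree with (t' := f j) in Hk.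
  - induction j as [|j IH]; [exact Hk|].
    apply IH. exact (HF (f j, j) k Hk).
  - intros i Hi. symmetry. now apply Hf.
Qed.

(** * Forced outputs of [r_minus] and the contradiction *)

Lemma output_forced (eta r_minus r_plus : code) (t : nat -> nat) (n : nat) :
  reduction eta r_minus r_plus -> exists j k, n <= k /\ forced eta t j k.
Proof.
  intros Hred.
  destruct (Hred _ (computable_const 0)) as (y & Hy & _ & Hminus & _).
  destruct (Hminus (alm_witness t (fun _ => 0))) as (b & Hb & Hw).
  { now apply alm_witness_correct. }
  destruct (maps_to_use _ _ _ (S (npair n 0)) Hb) as [U HU].
  exists U, (b (npair n 0)). split; [apply (Hw n)|].
  (* The use [U] serves both as the number of bounds to respect and as the required closeness to
     zero. *)
  exists U. intros x Hc Hh Hx Hr.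
  destruct (Hred _ Hc) as (y' & Hy' & _ & Hminus' & _).
  (* Rows below [U] keep the bounds [t]; the truth of [x] supplies bounds for the other rows, which
     [r_minus] does not see before output [n]. *)
  assert (Ht' : forall a, exists v, (a < U -> v = t a) /\
      forall i m, v <= i -> x (npair a (npair i m)) = 0).
  { intros a. destruct (le_lt_dec U a) as [HUa|HUa].
    - destruct (Hh a) as [v Hv]. exists v. split; [lia|].
      intros i m Hi. exact (Hv i Hi m).
    - exists (t a). split; [reflexivity|].
      intros i m Hi. now apply Hr. }
  apply choice_fun in Ht' as [t' Ht'].
  destruct (Hminus' (alm_witness t' x)) as (b' & Hb' & Hw').
  { apply alm_witness_correct. intros a i m. apply Ht'. }
  rewrite (HU (bjoin (alm_witness t' x) x) b'); [| |exact Hb'|lia].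
  - apply (good_iff _ _ _ _ Hy'). intros m. apply (Hw' n).
  - apply agree_bjoin; [|exact Hx]. apply agree_alm_witness; [|exact Hx].
    intros i Hi. symmetry. now apply Ht'.
Qed.

Theorem theorem4p14 :
  ~ m_reducible (canonical [qAll; qAlm; qAll]) (canonical [qInf; qAll]).
Proof.
  intros (eta & r_minus & r_plus & Hred).
  change (reduction eta r_minus r_plus) in Hred.
  destruct (stable_bounds _ _ _ Hred) as [t Ht].
  destruct (barred_bounded _ _ _ (fun _ => 0) 0 Hred) as [B HB].
  (* Output number [B] of [r_minus] is at least [B], yet being forced along [t] it is barred by the
     empty sequence. *)
  destruct (output_forced _ _ _ t B Hred) as (j & k & HBk & Hk).
  apply forced_barred, Ht, HB in Hk. lia.
Qed.
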